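(* Let $f\colon X\to Y$ be a continuous map. Then $\operatorname{TC}(f)=0$ if and only if $f$ is homotopic to a constant map.
   Context: Conventions: all spaces are pointed, path-connected and of the homotopy type of a CW-complex, and (globally given) continuous maps preserve base points; maps defined on open subsets, and homotopies, are not required to be based. For a space $X$ let $X^I$ be the space of continuous maps $I=[0,1]\to X$ and $\pi\colon X^I\to X\times X$, $\pi(\alpha)=(\alpha(0),\alpha(1))$, the path fibration. For a map $f\colon X\to Y$, the topological complexity $\operatorname{TC}(f)$ is the least $n\le\infty$ such that $X\times X$ can be covered by $n+1$ open sets $U_0,\dots,U_n$ on each of which there is a continuous map $\sigma_i\colon U_i\to X^I$ with $(f\times f)\circ\pi\circ\sigma_i\simeq (f\times f)|_{U_i}$. *)

(* Defs.v *)
From HB Require Import structures.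
From mathcomp Require Import all_boot all_order all_algebra.
From mathcomp Require Import all_classical all_reals.
From mathcomp Require Import topology normedtype.

Set Implicit Arguments.
Unset Strict Implicit.
Unset Printing Implicit Defensive.

Import Order.TTheory GRing.Theory Num.Theory.
Import numFieldTopology.Exports.

Local Open Scope classical_set_scope.
Local Open Scope ring_scope.

(* The reals are an arbitrary [R : realType].  Subsets used as spaces, such as
   the unit interval, the disks and the members of open covers, are coerced to
   [set_type], which carries the subspace topology. *)

Section Paths.
Variable R : realType.

Definition unit_interval : topologicalType :=
  set_type [set t : R | 0 <= t <= 1].

Lemma zero_in_unit_interval : (0 : R) \in [set t : R | 0 <= t <= 1].
Proof. by rewrite inE /= lexx ler01. Qed.

Lemma one_in_unit_interval : (1 : R) \in [set t : R | 0 <= t <= 1].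
Proof. by rewrite inE /= ler01 lexx. Qed.

Definition I0 : unit_interval := exist _ 0 zero_in_unit_interval.
Definition I1 : unit_interval := exist _ 1 one_in_unit_interval.

(* [X^I] with the compact-open topology. *)
Definition path_space (X : topologicalType) := continuousType unit_interval X.

HB.instance Definition _ (X : topologicalType) := Choice.on (path_space X).
HB.instance Definition _ (X : topologicalType) :=
  Topological.copy (path_space X)
    (initial_topology
       (fun a : path_space X => (a : {compact-open, unit_interval -> X}))).

Definition path_fibration (X : topologicalType) (a : path_space X) : X * X :=
  (a I0, a I1).

Definition path_connected (X : topologicalType) : Prop :=
  forall x y : X, exists a : path_space X, path_fibration a = (x, y).

(* Free homotopy: no base-point condition. *)
Definition homotopic (X Y : topologicalType) (f g : X -> Y) : Prop :=
  exists H : X * unit_interval -> Y,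
    [/\ continuous H,
        forall x, H (x, I0) = f x &
        forall x, H (x, I1) = g x].

Definition homotopy_equivalent (X Y : topologicalType) : Prop :=
  exists (f : X -> Y) (g : Y -> X),
    [/\ continuous f, continuous g,
        homotopic (g \o f) idfun &
        homotopic (f \o g) idfun].

End Paths.

Section CW.
Variable R : realType.

(* The norm of ['rV[R]_n] is the sup norm, hence the explicit sum of squares. *)
Definition sqnorm (n : nat) (v : 'rV[R]_n) : R := \sum_(i < n) v 0 i ^+ 2.

Definition disk (n : nat) : topologicalType :=
  set_type [set v : 'rV[R]_n | sqnorm v <= 1].

Definition open_disk (n : nat) : set (disk n) := [set p | sqnorm (\val p) < 1].

Definition boundary_sphere (n : nat) : set (disk n) :=
  [set p | sqnorm (\val p) = 1].

(* Whitehead's definition, by characteristic maps.  That each open cell is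
   homeomorphic to an open disk follows, by compactness of the disks, from the
   Hausdorff, injectivity, partition and boundary conditions. *)
Record cw_structure (X : topologicalType) := CWStructure {
  cell : Type;
  cell_dim : cell -> nat;
  char_map : forall c : cell, disk (cell_dim c) -> X;
  cw_hausdorff : hausdorff_space X;
  char_map_continuous : forall c, continuous (@char_map c);
  char_map_inj : forall c,
    {in @open_disk (cell_dim c) &, injective (@char_map c)};
  open_cells_partition : forall x : X,
    exists! c, (@char_map c @` @open_disk (cell_dim c)) x;
  closure_finite : forall c, exists F : set cell,
    [/\ finite_set F,
        forall d, F d -> (cell_dim d < cell_dim c)%N &
        @char_map c @` @boundary_sphere (cell_dim c) `<=`
          \bigcup_(d in F) (@char_map d @` @open_disk (cell_dim d))];
  weak_topology : forall A : set X,
    (forall c, closed (@char_map c @^-1` A)) -> closed A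
}.

Definition has_cw_homotopy_type (X : topologicalType) : Prop :=
  exists K : topologicalType,
    inhabited (cw_structure K) /\ homotopy_equivalent R X K.

End CW.

Section TopologicalComplexity.
Variables (R : realType) (X Y : topologicalType) (f : X -> Y).

Definition map_square (p : X * X) : Y * Y := (f p.1, f p.2).

Definition TC_local_section (U : set (X * X)) : Prop :=
  exists sigma : U -> path_space R X,
    continuous sigma /\
    homotopic R (fun u : U => map_square (path_fibration (sigma u)))
                (fun u : U => map_square (\val u)).

Definition TC_le (n : nat) : Prop :=
  exists U : 'I_n.+1 -> set (X * X),
    [/\ forall i, open (U i),
        \bigcup_i U i = [set: X * X] &
        forall i, TC_local_section (U i)].

(* [None] stands for the value infinity. *)
Definition TC : option nat :=
  if pselect (exists n, `[< TC_le n >]) is left ex then Some (ex_minn ex)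
  else None.

End TopologicalComplexity.

(* Main.v *)
Require Import Defs.
From mathcomp Require Import all_boot all_order all_algebra.
From mathcomp Require Import all_classical all_reals.
From mathcomp Require Import topology normedtype.
From mathcomp Require Import lra.


(** The value [TC(f) = 0] means that the whole of [X * X] carries a motion
    planner [s] whose endpoint map, followed by [f * f], is homotopic to [f * f].

    Given such an [s], running along the planned paths, [(u, t) |-> f (s u t)],
    is a homotopy from [f o (first endpoint)] to [f o (second endpoint)]; the
    two endpoint maps are, after [f], homotopic to the two projections followed
    by [f].  Hence [f o pr1] and [f o pr2] are homotopic on [X * X]
    ([TC_local_section_homotopic]).  Along the slice [x |-> (x, point)] these are
    [f] and a constant map.  The only topological input is that
    [(u, t) |-> s u t] is jointly continuous, which holds for the compact-open
    topology because the unit interval is locally compact and regular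
    ([evaluation_homotopic]).

    Conversely, if [f] is homotopic to a constant map, then [f * f] becomes
    homotopic to the same constant whatever it is precomposed with, so the
    planner that always returns one constant path is good enough
    ([TC_local_section_cst]).

    Both arguments chain homotopies, so free homotopy must first be shown to be
    symmetric and transitive.  Reparametrized homotopies are written with the
    retraction [clamp] of the line onto the unit interval, which lets their time
    be computed in the reals. *)

Set Implicit Arguments.
Unset Strict Implicit.
Unset Printing Implicit Defensive.

Import Order.TTheory GRing.Theory Num.Theory.
Import numFieldNormedType.Exports.

Local Open Scope classical_set_scope.
Local Open Scope ring_scope.

(** * Continuous maps and products *)

Lemma continuous_pair (T U V : topologicalType) (f : T -> U) (g : T -> V) :
  continuous f -> continuous g -> continuous (fun x => (f x, g x)).
Proof. by move=> cf cg x; apply: cvg_pair; [exact: cf|exact: cg]. Qed.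

Lemma continuous_compose (T U V : topologicalType) (f : T -> U) (g : U -> V) :
  continuous f -> continuous g -> continuous (fun x => g (f x)).
Proof. by move=> cf cg x; apply: continuous_comp; [exact: cf|exact: cg]. Qed.

Lemma fst_continuous (T U : topologicalType) : continuous (@fst T U).
Proof. by move=> p; exact: cvg_fst. Qed.

Lemma snd_continuous (T U : topologicalType) : continuous (@snd T U).
Proof. by move=> p; exact: cvg_snd. Qed.

(** * The unit interval as a retract of the line *)

Section UnitInterval.
Variable R : realType.
Local Notation I := (unit_interval R).

Lemma clamp_in_unit_interval (t : R) :
  Num.max 0 (Num.min 1 t) \in [set t : R | 0 <= t <= 1].
Proof.
by rewrite inE /= le_max lexx /= ge_max ler01 ge_min lexx.
Qed.

Definition clamp (t : R) : I := 
  exist (fun s => s \in [set s : R | 0 <= s <= 1]) _ (clamp_in_unit_interval t).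

Lemma val_clamp (t : R) : 0 <= t <= 1 -> \val (clamp t) = t.
Proof. by move=> /andP[t0 t1] /=; rewrite (min_idPr t1) (max_idPr t0). Qed.

Lemma clampK (t : I) : clamp (\val t) = t.
Proof. by apply: val_inj; rewrite val_clamp//; have := set_mem (valP t). Qed.

Lemma clamp_le0 (t : R) : t <= 0 -> clamp t = I0 R.
Proof.
move=> t0; apply: val_inj => /=.
by rewrite (min_idPr (le_trans t0 ler01)) (max_idPl t0).
Qed.

Lemma clamp_ge1 (t : R) : 1 <= t -> clamp t = I1 R.
Proof.
by move=> t1; apply: val_inj => /=; rewrite (min_idPl t1) (max_idPr ler01).
Qed.

Lemma clamp_continuous : continuous clamp.
Proof.
apply: (@continuous_comp_initial I R R set_val) => t.
apply: (@continuous_max R R (cst 0) (fun t => Num.min 1 t)).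
  exact: cst_continuous.
apply: (@continuous_min R R (cst 1) id); first exact: cst_continuous.
by move=> s; exact: cvg_id.
Qed.

Lemma unit_interval_val_continuous : continuous (\val : I -> R).
Proof. exact: (@initial_continuous I R set_val). Qed.

(** The interval is the image under [clamp] of a segment of the line, whose
    compactness is Heine-Borel. *)
Lemma unit_interval_compact : compact [set: I].
Proof.
have -> : [set: I] = clamp @` `[0, 1].
  apply/esym/seteqP; split=> // t _; exists (\val t); last exact: clampK.
  by have := set_mem (valP t); rewrite /= in_itv.
apply: continuous_compact; last exact: segment_compact.
exact/continuous_subspaceT/clamp_continuous.
Qed.

Lemma unit_interval_locally_compact : locally_compact [set: I].
Proof.
move=> t _; rewrite withinET; exists setT; first exact: filterT.
by split; [exact: unit_interval_compact|exact: closedT].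
Qed.

Lemma unit_interval_regular : regular_space I.
Proof. exact: (@uniform_regular (set_type [set t : R | 0 <= t <= 1])). Qed.

End UnitInterval.

(** * Free homotopy *)

Section Homotopy.
Variable R : realType.
Local Notation I := (unit_interval R).

Lemma reparametrize_continuous (X Y : topologicalType) (H : X * I -> Y)
  (phi : R -> R) : continuous H -> continuous phi ->
  continuous (fun p : X * I => H (p.1, clamp (phi (\val p.2)))).
Proof.
move=> cH cphi; apply: (continuous_compose _ cH).
apply: continuous_pair; first exact: fst_continuous.
apply: (continuous_compose _ (@clamp_continuous R)).
apply: (continuous_compose _ cphi).
exact: (continuous_compose (@snd_continuous _ _)
  (@unit_interval_val_continuous R)).
Qed.

Lemma homotopic_sym (X Y : topologicalType) (f g : X -> Y) :
  homotopic R f g -> homotopic R g f.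
Proof.
case=> H [cH H0 H1]; exists (fun p : X * I => H (p.1, clamp (1 - \val p.2))).
split=> [|x|x].
- apply: (@reparametrize_continuous _ _ H (fun t => 1 - t)) => // t.
  by apply: cvgB; [exact: cvg_cst|exact: cvg_id].
- by rewrite clamp_ge1 ?H1 //= subr0.
- by rewrite clamp_le0 ?H0 //= subrr.
Qed.

(** The two homotopies are run one after the other at double speed and pasted
    along the closed sets of times before and after one half. *)
Lemma homotopic_trans (X Y : topologicalType) (f g h : X -> Y) :
  homotopic R f g -> homotopic R g h -> homotopic R f h.
Proof.
case=> H [cH H0 H1] [K [cK K0 K1]].
pose first_half (p : X * I) := H (p.1, clamp (2 * \val p.2)).
pose second_half (p : X * I) := K (p.1, clamp (2 * \val p.2 - 1)).
have c1 : continuous first_half.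
  apply: (@reparametrize_continuous _ _ H (fun t => 2 * t)) => // t.
  by apply: cvgMr; exact: cvg_id.
have c2 : continuous second_half.
  apply: (@reparametrize_continuous _ _ K (fun t => 2 * t - 1)) => // t.
  by apply: cvgB; [apply: cvgMr; exact: cvg_id|exact: cvg_cst].
pose time (p : X * I) : R := \val p.2.
have ctime : continuous time.
  exact: (continuous_compose (@snd_continuous _ _)
    (@unit_interval_val_continuous R)).
pose A := time @^-1` [set t | t <= 2^-1].
pose B := time @^-1` [set t | 2^-1 <= t].
pose L p := if time p <= 2^-1 then first_half p else second_half p.
have LA : {in A, first_half =1 L}.
  by move=> p; rewrite inE /L => /= ->.
have LB : {in B, second_half =1 L}.
  (* The halves overlap only at time 1/2, where both give [g]. *)
  move=> p; rewrite inE /L => /= pB; case: ifP => // pA.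
  have pE : time p = 2^-1 by apply/eqP; rewrite eq_le pA pB.
  rewrite /first_half /second_half -/(time p) pE divff ?pnatr_eq0//.
  by rewrite subrr (clamp_ge1 (lexx 1)) (clamp_le0 (lexx 0)) H1 K0.
have AB : A `|` B = setT.
  apply/seteqP; split=> // p _; rewrite /A /B /=.
  by have [?|/ltW ?] := leP (time p) 2^-1; [left|right].
exists L; split=> [|x|x].
- apply/continuous_subspace_setT; rewrite -AB.
  apply: withinU_continuous.
  + apply: preimage_closed; last exact: closed_le.
    by move=> p _; exact: ctime.
  + apply: preimage_closed; last exact: closed_ge.
    by move=> p _; exact: ctime.
  + exact: (subspace_eq_continuous LA (continuous_subspaceT c1)).
  + exact: (subspace_eq_continuous LB (continuous_subspaceT c2)).
- rewrite /L /time /= invr_ge0 ler0n /first_half /=.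
  by rewrite clamp_le0 ?H0// mulr0.
- rewrite /L /time /= ifF /second_half; last by apply/negbTE; rewrite -ltNge; lra.
  by rewrite clamp_ge1 ?K1//=; lra.
Qed.

Lemma homotopic_precomp (W X Y : topologicalType) (k : W -> X) (f g : X -> Y) :
  continuous k -> homotopic R f g ->
  homotopic R (fun w => f (k w)) (fun w => g (k w)).
Proof.
move=> ck [H [cH H0 H1]]; exists (fun p => H (k p.1, p.2)).
split=> [|w|w]; [|exact: H0|exact: H1].
apply: (continuous_compose _ cH); apply: continuous_pair.
  exact: (continuous_compose (@fst_continuous _ _) ck).
exact: snd_continuous.
Qed.

Lemma homotopic_postcomp (X Y Z : topologicalType) (f g : X -> Y) (k : Y -> Z) :
  continuous k -> homotopic R f g ->
  homotopic R (fun x => k (f x)) (fun x => k (g x)).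
Proof.
move=> ck [H [cH H0 H1]]; exists (fun p => k (H p)).
by split=> [|w|w]; [exact: (continuous_compose cH ck)|rewrite H0|rewrite H1].
Qed.

Lemma homotopic_map_square (X Y : topologicalType) (f g : X -> Y) :
  homotopic R f g -> homotopic R (map_square f) (map_square g).
Proof.
case=> H [cH H0 H1]; exists (fun p => (H (p.1.1, p.2), H (p.1.2, p.2))).
split=> [|w|w]; [|by rewrite /map_square !H0|by rewrite /map_square !H1].
have cfst := @fst_continuous (X * X)%type I; have csnd := @snd_continuous (X * X)%type I.
apply: continuous_pair; apply: (continuous_compose _ cH);
  apply: continuous_pair => //; apply: (continuous_compose cfst).
- exact: fst_continuous.
- exact: snd_continuous.
Qed.

End Homotopy.

(** * Motion planners *)

Section TopologicalComplexity.
Variable R : realType.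
Local Notation I := (unit_interval R).

(** Currying: a continuous family of paths is a homotopy between its two
    endpoint maps. *)
Lemma evaluation_homotopic (W X : topologicalType) (s : W -> path_space R X) :
  continuous s ->
  homotopic R (fun w => (path_fibration (s w)).1)
              (fun w => (path_fibration (s w)).2).
Proof.
move=> cs.
exists (uncurry (fun w : W => s w : {compact-open, I -> X})); split=> //.
apply: continuous_uncurry_regular.
- exact: unit_interval_locally_compact.
- exact: unit_interval_regular.
- apply: (@continuous_compose W (path_space R X) {compact-open, I -> X} s
    (fun a => a : {compact-open, I -> X})) => //.
  exact: (@initial_continuous (path_space R X) {compact-open, I -> X}
    (fun a : path_space R X => (a : {compact-open, I -> X}))).
- by move=> w; exact: cts_fun.
Qed.

(** The homotopy that makes [s] a section up to [f * f] is projected to each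
    factor, so that it links [f] after either projection with [f] after the
    corresponding endpoint of the path [s u]; running along that path links the
    two endpoints. *)
Lemma TC_local_section_homotopic (X Y : topologicalType) (f : X -> Y)
  (U : set (X * X)) : continuous f -> TC_local_section R f U ->
  homotopic R (fun u : U => f (\val u).1) (fun u : U => f (\val u).2).
Proof.
move=> cf [s [cs sf]].
have e1 := homotopic_postcomp (@fst_continuous Y Y) sf.
have e2 := homotopic_postcomp (@snd_continuous Y Y) sf.
have e := homotopic_postcomp cf (evaluation_homotopic cs).
exact: homotopic_trans (homotopic_sym e1) (homotopic_trans e e2).
Qed.

(** Both [f * f] restricted to [U] and the endpoint map of a constant planner
    followed by [f * f] are restrictions of [f * f] along some map, and are
    therefore homotopic to [cst (y, y)]. *)
Lemma TC_local_section_cst (X Y : topologicalType) (f : X -> Y) (x0 : X)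
  (y : Y) (U : set (X * X)) :
  homotopic R f (cst y) -> TC_local_section R f U.
Proof.
move=> fy; exists (fun=> cst x0 : path_space R X).
split; first exact: cst_continuous.
have ff := homotopic_map_square fy.
have cval : continuous (\val : U -> X * X).
  exact: (@initial_continuous U (X * X)%type set_val).
have e1 := homotopic_precomp (@cst_continuous U _ (x0, x0)) ff.
exact: homotopic_trans e1 (homotopic_sym (homotopic_precomp cval ff)).
Qed.

Lemma TC_eq0 (X Y : topologicalType) (f : X -> Y) :
  TC R f = Some 0%N <-> TC_le R f 0.
Proof.
rewrite /TC; case: pselect => [ex|nex].
  case: ex_minnP => m /asboolP m_le m_min; split=> [[m0]|le0].
    by rewrite -m0.
  by have := m_min 0%N; rewrite leqn0 => /(_ (asboolT le0)) /eqP ->.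
by split=> // le0; case: nex; exists 0%N; exact/asboolP.
Qed.

Lemma TC_le0 (X Y : topologicalType) (f : X -> Y) :
  TC_le R f 0 <-> TC_local_section R f [set: X * X].
Proof.
split=> [[U [_ Ucov Usec]]|sec]; last first.
  exists (fun=> setT); split=> [i||//]; first exact: openT.
  by apply/seteqP; split=> // p _; exists ord0.
suff <- : U ord0 = setT by exact: Usec.
rewrite -Ucov; apply/seteqP; split=> [p Up|p [i _]]; first by exists ord0.
by rewrite (ord1 i).
Qed.

End TopologicalComplexity.

Theorem corollary2p3 (R : realType) (X Y : ptopologicalType)
  (X_path_connected : path_connected R X)
  (Y_path_connected : path_connected R Y)
  (X_cw : has_cw_homotopy_type R X)
  (Y_cw : has_cw_homotopy_type R Y)
  (f : X -> Y) (f_continuous : continuous f) (f_based : f point = point) :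
  TC R f = Some 0%N <-> exists y : Y, homotopic R f (cst y).
Proof.
rewrite TC_eq0 TC_le0; split=> [sec|[y fy]]; last first.
  exact: (TC_local_section_cst point _ fy).
exists (f point).
pose slice (x : X) : [set: X * X] := SigSub (mem_set (I : setT (x, point))).
have cslice : continuous slice.
  apply: (@continuous_comp_initial [set: X * X] X (X * X)%type set_val).
  apply: continuous_pair; first by move=> x; exact: cvg_id.
  exact: cst_continuous.
exact: (homotopic_precomp cslice (TC_local_section_homotopic f_continuous sec)).
Qed.
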